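(* Let $G$ be a group, let $Q$ be a finite group acting on $G$ by group automorphisms, and let $A$ be an abelian group with trivial $G$- and $Q$-actions. Assume that $|Q|$ is invertible in $A$. Then the natural map $$i_*: H_\bullet^Q(G;A)\longrightarrow H_\bullet(G;A)^Q$$ is an isomorphism.
   Context: $C_\bullet(G)$ is the (unnormalized) bar complex: $C_i(G)$ is the free abelian group on symbols $[g_1|\cdots|g_i]$ with $g_j\in G$, with boundary $d[g_1|\cdots|g_i]=[g_2|\cdots|g_i]+\sum_{k=1}^{i-1}(-1)^k[g_1|\cdots|g_kg_{k+1}|\cdots|g_i]+(-1)^i[g_1|\cdots|g_{i-1}]$. Set $C_\bullet(G;A)=C_\bullet(G)\otimes A$ with boundary $d\otimes 1$. $Q$ acts on $C_\bullet(G;A)$ by $q([g_1|\cdots|g_i]\otimes a)=[q(g_1)|\cdots|q(g_i)]\otimes a$, and $C_\bullet(G;A)^Q$ is the subcomplex of $Q$-invariant chains. Define $H_\bullet^Q(G;A)$ as the homology of $C_\bullet(G;A)^Q$. $H_\bullet(G;A)$ is ordinary group homology (homology of $C_\bullet(G;A)$), with induced $Q$-action, and $H_\bullet(G;A)^Q$ is its subgroup of $Q$-invariant classes. The natural map $i_*$ is induced by the inclusion $C_\bullet(G;A)^Q\to C_\bullet(G;A)$; its image lies in $H_\bullet(G;A)^Q$. ''$|Q|$ is invertible in $A$'' means multiplication by $|Q|$ is an automorphism of $A$. *)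

(* Defs.v *)
From HB Require Import structures.
From mathcomp Require Import all_boot all_order fingroup all_algebra.
From mathcomp Require Import generic_quotient ring_quotient boolp freeg.
From mathcomp Require Import zify.

Set Implicit Arguments.
Unset Strict Implicit.
Unset Printing Implicit Defensive.

Import GRing.Theory.
Local Open Scope ring_scope.
Local Open Scope quotient_scope.

(** Subgroups and quotients of abelian groups *)

Record subgrp (V : zmodType) (S : zmodClosed V) :=
  SubGrp { zval : V; _ : zval \in S }.
Arguments zval {V S} s.

Section SubGrp.
Variables (V : zmodType) (S : zmodClosed V).
HB.instance Definition _ := [isSub for @zval V S].
HB.instance Definition _ := [Choice of subgrp S by <:].
HB.instance Definition _ := [SubChoice_isSubZmodule of subgrp S by <:].

Lemma zvalP (x : subgrp S) : zval x \in S. Proof. exact: valP x. Qed.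

Lemma zval_inj : injective (@zval V S). Proof. exact: val_inj. Qed.

Fact zval_is_zmod_morphism : zmod_morphism (@zval V S).
Proof. by []. Qed.
HB.instance Definition _ :=
  GRing.isZmodMorphism.Build _ _ (@zval V S) zval_is_zmod_morphism.
End SubGrp.

Section SubGrpCorestrict.
Variables (U V : zmodType) (S : zmodClosed V) (f : {additive U -> V}).
Hypothesis fS : forall x, f x \in S.

Definition corestr (x : U) : subgrp S := SubGrp (fS x).

Fact corestr_is_zmod_morphism : zmod_morphism corestr.
Proof. by move=> x y; apply: val_inj; rewrite /= raddfB. Qed.
HB.instance Definition _ :=
  GRing.isZmodMorphism.Build _ _ corestr corestr_is_zmod_morphism.
End SubGrpCorestrict.
Arguments corestr {U V S} f fS x.

Section QuotientLift.
Variables (V U : zmodType) (S : zmodClosed V).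

Definition qclass (x : V) : Quotient.quot S := \pi_(Quotient.quot S) x.

Fact qclass_is_zmod_morphism : zmod_morphism qclass.
Proof. by move=> x y; rewrite /qclass raddfB. Qed.
HB.instance Definition _ :=
  GRing.isZmodMorphism.Build _ _ qclass qclass_is_zmod_morphism.

Lemma qclass_eq x y : (qclass x == qclass y) = (x - y \in S).
Proof. by rewrite /qclass -Quotient.idealrBE. Qed.

Lemma qclassK (x : Quotient.quot S) : qclass (repr x) = x.
Proof. exact: reprK. Qed.

Variables (f : {additive V -> U}).
Hypothesis fS : forall x, x \in S -> f x = 0.

Definition quot_lift of (forall x, x \in S -> f x = 0) :=
  fun x : Quotient.quot S => f (repr x) : U.

Lemma quot_liftE x : quot_lift fS (qclass x) = f x.
Proof.
apply/eqP; rewrite -subr_eq0 -raddfB; apply/eqP/fS.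
by rewrite -qclass_eq qclassK.
Qed.

Fact quot_lift_is_zmod_morphism : zmod_morphism (quot_lift fS).
Proof.
move=> x y; rewrite -(qclassK x) -(qclassK y).
by rewrite -raddfB !quot_liftE raddfB.
Qed.
HB.instance Definition _ :=
  GRing.isZmodMorphism.Build _ _ (quot_lift fS) quot_lift_is_zmod_morphism.
End QuotientLift.
Arguments quot_lift {V U S} f fS x : simpl never.

Section Generated.
Variables (V : zmodType) (R : V -> Prop).

Definition generated : {pred V} := fun x =>
  `[< forall S : zmodClosed V, (forall y, R y -> y \in S) -> x \in S >].

Lemma genP x : reflect
  (forall S : zmodClosed V, (forall y, R y -> y \in S) -> x \in S) (x \in generated).
Proof. exact: asboolP. Qed.

Fact gen_zmod_closed : zmod_closed generated.
Proof.
split; first by apply/genP => S _; rewrite rpred0.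
move=> x y /genP xS /genP yS; apply/genP => S RS.
by rewrite rpredB ?xS ?yS.
Qed.
HB.instance Definition _ := GRing.isZmodClosed.Build V generated gen_zmod_closed.
End Generated.

Section Kernel.
Variables (V U : zmodType) (f : {additive V -> U}).

Definition kerz : {pred V} := fun x => f x == 0.

Fact kerz_zmod_closed : zmod_closed kerz.
Proof.
split; first by rewrite /in_mem /= /kerz raddf0.
by move=> x y /eqP fx /eqP fy; rewrite /in_mem /= /kerz raddfB fx fy subrr.
Qed.
HB.instance Definition _ := GRing.isZmodClosed.Build V kerz kerz_zmod_closed.
End Kernel.

(** Free abelian groups [{freeg K}] *)

Section FreeAbelian.
Variables (K : choiceType) (V : zmodType).

Definition fglin (f : K -> V) (D : {freeg K}) : V :=
  fglift (f : K -> zmodule V) D.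

Fact fglin_is_zmod_morphism f : zmod_morphism (fglin f).
Proof. exact: (@lift_is_additive int K (zmodule V) f). Qed.
HB.instance Definition _ f :=
  GRing.isZmodMorphism.Build _ _ (fglin f) (fglin_is_zmod_morphism f).

Lemma fglinU f c k : fglin f << c *g k >> = f k *~ c.
Proof. by rewrite /fglin fglift_Freeg prelift_seq1. Qed.

Lemma fg_ext (f g : {additive {freeg K} -> V}) :
  (forall k, f << k >> = g << k >>) -> f =1 g.
Proof.
move=> fg D; rewrite -(freeg_sumE D) !raddf_sum; apply: eq_bigr => k _.
have -> : << coeff k D *g k >> = << k >> *~ coeff k D.
  by rewrite freeg_mulz intz.
by rewrite !raddfMz fg.
Qed.
End FreeAbelian.

(** Tensor product of abelian groups *)

Section Tensor.
Variables V W : zmodType.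

Inductive tensor_rel : {freeg (V * W)%type} -> Prop :=
| TensorRelL v v' w :
    tensor_rel (<< (v + v', w) >> - << (v, w) >> - << (v', w) >>)
| TensorRelR v w w' :
    tensor_rel (<< (v, w + w') >> - << (v, w) >> - << (v, w') >>).

(* [V (x) W] over the integers: balancing [mv (x) w = v (x) mw] follows from
   biadditivity. *)
Definition tensor : zmodType := Quotient.quot (generated tensor_rel).

Definition pure (v : V) (w : W) : tensor :=
  qclass (generated tensor_rel) << (v, w) >>.

Lemma pureDl w : {morph pure^~ w : v v' / v + v'}.
Proof.
move=> v v'; rewrite /pure -raddfD; apply/eqP; rewrite qclass_eq.
by apply/genP => S; apply; rewrite opprD addrA; exact: TensorRelL.
Qed.

Lemma pureDr v : {morph pure v : w w' / w + w'}.
Proof.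
move=> w w'; rewrite /pure -raddfD; apply/eqP; rewrite qclass_eq.
by apply/genP => S; apply; rewrite opprD addrA; exact: TensorRelR.
Qed.

Lemma pure0l w : pure 0 w = 0.
Proof.
have: pure (0 + 0) w - pure 0 w = pure 0 w by rewrite pureDl addrK.
by move=> <-; rewrite addr0 subrr.
Qed.
End Tensor.

Section TensorLift.
Variables (V W U : zmodType) (f : V -> W -> U).
Hypothesis fDl : forall w, {morph f^~ w : v v' / v + v'}.
Hypothesis fDr : forall v, {morph f v : w w' / w + w'}.

Fact tensor_lift_subproof x : x \in generated (@tensor_rel V W) ->
  fglin (fun p : V * W => f p.1 p.2) x = 0.
Proof.
move=> /genP/(_ (kerz (fglin (fun p : V * W => f p.1 p.2)))) xker.
apply/eqP; apply: xker => y; rewrite /in_mem /= /kerz.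
case=> [v v' w|v w w']; rewrite !raddfB /= !fglinU !mulr1z /= (fDl, fDr).
  by rewrite [f v w + _]addrC addrK subrr.
by rewrite [f v w + _]addrC addrK subrr.
Qed.

Definition tensor_lift : tensor V W -> U :=
  quot_lift (fglin (fun p : V * W => f p.1 p.2)) tensor_lift_subproof.

Fact tensor_lift_is_zmod_morphism : zmod_morphism tensor_lift.
Proof. exact: raddfB. Qed.
HB.instance Definition _ :=
  GRing.isZmodMorphism.Build _ _ tensor_lift tensor_lift_is_zmod_morphism.

Lemma tensor_liftE v w : tensor_lift (pure v w) = f v w.
Proof. by rewrite /tensor_lift quot_liftE /= fglinU mulr1z. Qed.
End TensorLift.
Arguments tensor_lift {V W U f} fDl fDr x : simpl never.

Lemma tensor_ext (V W U : zmodType) (f g : {additive tensor V W -> U}) :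
  (forall v w, f (pure v w) = g (pure v w)) -> f =1 g.
Proof.
move=> fg x; rewrite -(qclassK x).
pose p : {additive _ -> tensor V W} := qclass (generated (@tensor_rel V W)).
by apply: (@fg_ext _ _ (f \o p) (g \o p)) => -[v w]; apply: fg.
Qed.

Section TensorMap.
Variables (V W V' W' : zmodType).
Variables (f : {additive V -> V'}) (g : {additive W -> W'}).

Fact tensor_mapDl w : {morph (fun v => pure (f v) (g w)) : v v' / v + v'}.
Proof. by move=> v v'; rewrite raddfD pureDl. Qed.
Fact tensor_mapDr v : {morph (fun w => pure (f v) (g w)) : w w' / w + w'}.
Proof. by move=> w w'; rewrite raddfD pureDr. Qed.

Definition tensor_map : tensor V W -> tensor V' W' :=
  tensor_lift tensor_mapDl tensor_mapDr.

Fact tensor_map_is_zmod_morphism : zmod_morphism tensor_map.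
Proof. exact: raddfB. Qed.
HB.instance Definition _ :=
  GRing.isZmodMorphism.Build _ _ tensor_map tensor_map_is_zmod_morphism.

Lemma tensor_mapE v w : tensor_map (pure v w) = pure (f v) (g w).
Proof. exact: tensor_liftE. Qed.
End TensorMap.
Arguments tensor_map {V W V' W'} f g x : simpl never.

(** Chain complexes in nonnegative degrees and their homology *)

Record chain_complex := Complex {
  chain :> nat -> zmodType;
  bd : forall n, {additive chain n.+1 -> chain n};
  bdbd : forall n x, bd n (bd n.+1 x) = 0
}.

Record chain_map (C D : chain_complex) := ChainMap {
  cmap :> forall n, {additive C n -> D n};
  cmapP : forall n x, cmap n (bd C n x) = bd D n (cmap n.+1 x)
}.

Section Homology.
Variables (C : chain_complex) (n : nat).

(* The boundary out of degree 0 is zero. *)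
Definition is_cycle : {pred C n} :=
  match n return C n -> bool with
  | 0 => fun=> true
  | m.+1 => fun x => bd C m x == 0
  end.

Fact is_cycle_zmod_closed : zmod_closed is_cycle.
Proof.
rewrite /is_cycle; case: n => [//|m]; exact: (kerz_zmod_closed (bd C m)).
Qed.
HB.instance Definition _ :=
  GRing.isZmodClosed.Build (C n) is_cycle is_cycle_zmod_closed.

Definition cycles : zmodType := subgrp is_cycle.

Definition is_boundary : {pred cycles} := fun z =>
  `[< exists y : C n.+1, zval z = bd C n y >].

Lemma is_boundaryP (z : cycles) :
  reflect (exists y : C n.+1, zval z = bd C n y) (z \in is_boundary).
Proof. exact: asboolP. Qed.

Fact is_boundary_zmod_closed : zmod_closed is_boundary.
Proof.
split; first by apply/is_boundaryP; exists 0; rewrite !raddf0.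
move=> x y /is_boundaryP[u xu] /is_boundaryP[v yv].
by apply/is_boundaryP; exists (u - v); rewrite !raddfB /= xu yv.
Qed.
HB.instance Definition _ :=
  GRing.isZmodClosed.Build cycles is_boundary is_boundary_zmod_closed.

Definition homology : zmodType := Quotient.quot is_boundary.

Definition hclass (z : cycles) : homology := qclass is_boundary z.
End Homology.
Arguments is_cycle C n : clear implicits.
Arguments is_boundary C n : clear implicits.

Section HomologyMap.
Variables (C D : chain_complex) (f : chain_map C D) (n : nat).

Fact cycles_map_subproof (z : cycles C n) : f n (zval z) \in is_cycle D n.
Proof.
case: z => x /=; rewrite !unfold_in /is_cycle; move: x; case: n => [//|m] x.
by move=> /eqP dx; rewrite -cmapP dx raddf0.
Qed.

Definition cycles_map : cycles C n -> cycles D n :=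
  corestr (f n \o zval) cycles_map_subproof.

Fact cycles_map_is_zmod_morphism : zmod_morphism cycles_map.
Proof. exact: raddfB. Qed.
HB.instance Definition _ :=
  GRing.isZmodMorphism.Build _ _ cycles_map cycles_map_is_zmod_morphism.

Fact homology_map_subproof (z : cycles C n) :
  z \in is_boundary C n -> (qclass (is_boundary D n) \o cycles_map) z = 0.
Proof.
move=> /is_boundaryP[y zy]; apply/eqP; rewrite -(raddf0 (qclass _)) qclass_eq.
by rewrite subr0; apply/is_boundaryP; exists (f n.+1 y); rewrite /= zy cmapP.
Qed.

Definition homology_map : homology C n -> homology D n :=
  quot_lift (qclass (is_boundary D n) \o cycles_map) homology_map_subproof.

Fact homology_map_is_zmod_morphism : zmod_morphism homology_map.
Proof. exact: raddfB. Qed.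
HB.instance Definition _ :=
  GRing.isZmodMorphism.Build _ _ homology_map homology_map_is_zmod_morphism.

Lemma homology_mapE z : homology_map (hclass z) = hclass (cycles_map z).
Proof. exact: quot_liftE. Qed.
End HomologyMap.
Arguments homology_map {C D} f n x : simpl never.

(** Finite group actions on complexes *)

Record complex_action (Q : finGroupType) (C : chain_complex) := ComplexAction {
  cact :> Q -> chain_map C C;
  cact1 : forall n x, cact 1%g n x = x;
  cactM : forall q r n x, cact (q * r)%g n x = cact q n (cact r n x)
}.

Section Invariants.
Variables (Q : finGroupType) (C : chain_complex) (rho : complex_action Q C).

Section Degree.
Variable n : nat.

Definition inv_chain : {pred C n} := fun x => [forall q, rho q n x == x].

Fact inv_chain_zmod_closed : zmod_closed inv_chain.
Proof.
split; first by apply/forallP => q; rewrite raddf0.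
move=> x y /forallP xP /forallP yP; apply/forallP => q.
by rewrite raddfB (eqP (xP q)) (eqP (yP q)).
Qed.
HB.instance Definition _ :=
  GRing.isZmodClosed.Build (C n) inv_chain inv_chain_zmod_closed.

Definition inv_class : {pred homology C n} := fun h =>
  [forall q, homology_map (rho q) n h == h].

Fact inv_class_zmod_closed : zmod_closed inv_class.
Proof.
split; first by apply/forallP => q; rewrite raddf0.
move=> x y /forallP xP /forallP yP; apply/forallP => q.
by rewrite raddfB /= (eqP (xP q)) (eqP (yP q)).
Qed.
HB.instance Definition _ :=
  GRing.isZmodClosed.Build (homology C n) inv_class inv_class_zmod_closed.

Definition inv_homology : zmodType := subgrp inv_class.
End Degree.
Arguments inv_chain n : clear implicits.
Arguments inv_class n : clear implicits.

Lemma inv_chainP n (x : subgrp (inv_chain n)) q :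
  rho q n (zval x) = zval x.
Proof. by have /forallP/(_ q)/eqP := zvalP x. Qed.

Fact inv_bd_subproof n (x : subgrp (inv_chain n.+1)) :
  bd C n (zval x) \in inv_chain n.
Proof.
by apply/forallP => q; rewrite cmapP inv_chainP.
Qed.

Definition inv_bd n :
    {additive subgrp (inv_chain n.+1) -> subgrp (inv_chain n)} :=
  corestr (bd C n \o zval) (@inv_bd_subproof n).

Fact inv_bdbd n x : inv_bd n (inv_bd n.+1 x) = 0.
Proof. by apply: zval_inj; rewrite /= bdbd. Qed.

Definition inv_complex : chain_complex :=
  @Complex (fun n => subgrp (inv_chain n)) inv_bd inv_bdbd.

Definition inv_incl : chain_map inv_complex C :=
  @ChainMap inv_complex C (fun n => @zval _ (inv_chain n)) (fun _ _ => erefl).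

Fact inv_homology_map_subproof n (h : homology inv_complex n) :
  homology_map inv_incl n h \in inv_class n.
Proof.
apply/forallP => q; rewrite -(qclassK h) -/(hclass _) !homology_mapE.
apply/eqP; congr hclass; apply: zval_inj => /=.
exact: inv_chainP.
Qed.

Definition inv_homology_map n :
    {additive homology inv_complex n -> inv_homology n} :=
  corestr (homology_map inv_incl n) (@inv_homology_map_subproof n).
End Invariants.
Arguments inv_chain {Q C} rho n.
Arguments inv_class {Q C} rho n.

(** The bar complex *)

Section Bar.
Variable G : groupType.

Section Faces.
Variable n : nat.
Implicit Types t : n.+1.-tuple G.

(* On 0-based entries [t_0, ..., t_n]: [fintype.lift ord0 j] has value [j.+1] and
   [widen_ord (leqnSn n) j] has value [j]. *)
Definition drop_first t : n.-tuple G :=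
  [tuple tnth t (fintype.lift ord0 j) | j < n].

Definition drop_last t : n.-tuple G :=
  [tuple tnth t (widen_ord (leqnSn n) j) | j < n].

Definition merge_at (k : 'I_n) t : n.-tuple G :=
  [tuple if (j < k)%N then tnth t (widen_ord (leqnSn n) j)
         else if j == k
              then (tnth t (widen_ord (leqnSn n) j) * tnth t (fintype.lift ord0 j))%g
         else tnth t (fintype.lift ord0 j) | j < n].

Definition bar_bd_symbol t : {freeg (n.-tuple G)} :=
  << drop_first t >>
  + \sum_(k < n) << (-1) ^+ k.+1 *g merge_at k t >>
  + << (-1) ^+ n.+1 *g drop_last t >>.

Definition bar_bd : {freeg (n.+1.-tuple G)} -> {freeg (n.-tuple G)} :=
  fglin bar_bd_symbol.
HB.instance Definition _ :=
  GRing.isZmodMorphism.Build _ _ bar_bd (fglin_is_zmod_morphism bar_bd_symbol).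

Lemma bar_bdU c t : bar_bd << c *g t >> = bar_bd_symbol t *~ c.
Proof. exact: fglinU. Qed.
End Faces.
Arguments bar_bd n x : clear implicits.

Section FaceIdentities.

Definition facef (i : nat) (u : nat -> G) (j : nat) : G :=
  if (j.+1 < i)%N then u j else
  if j.+1 == i then (u j * u j.+1)%g else u j.+1.

Definition face n i (t : n.+1.-tuple G) : n.-tuple G :=
  [tuple facef i (nth 1%g t) j | j < n].

Lemma bar_bd_symbolE n (t : n.+1.-tuple G) :
  bar_bd_symbol t = \sum_(0 <= i < n.+2) << (-1) ^+ i *g face i t >>.
Proof.
rewrite big_mkord big_ord_recl big_ord_recr /= addrA /bar_bd_symbol.
congr (_ + _ + _); last 1 first.
- congr << _ *g _ >>; apply: eq_from_tnth => j; rewrite !tnth_mktuple /facef.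
  by rewrite /= /bump /= add1n ltnS ltn_ord (tnth_nth 1%g).
- rewrite expr0; congr << _ *g _ >>; apply: eq_from_tnth => j.
  by rewrite !tnth_mktuple /facef /= (tnth_nth 1%g).
apply: eq_bigr => k _; rewrite /= /bump /= add1n.
congr << _ *g _ >>; apply: eq_from_tnth => j.
by rewrite !tnth_mktuple /facef /= !(tnth_nth 1%g) ltnS eqSS.
Qed.

Lemma facef_comm i j u x : (i < j)%N ->
  facef i (facef j u) x = facef j.-1 (facef i u) x.
Proof.
case: j => // j; rewrite ltnS /= /facef => ij.
case: (ltngtP x.+1 i) => xi; case: (ltngtP x.+1 j) => xj;
  rewrite ?ltnS ?eqSS; try (exfalso; lia).
all: do ?[case: ifP => ?]; try (exfalso; lia); try done.
all: by rewrite mulgA.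
Qed.

Lemma face_comm n i j (t : n.+2.-tuple G) : (i < j <= n.+2)%N ->
  face i (face j t) = face j.-1 (face i t).
Proof.
move=> /andP[ij jn]; apply: eq_from_tnth => x; rewrite !tnth_mktuple.
have E k (y : nat) : (y < n.+1)%N ->
    nth 1%g (face k t) y = facef k (nth 1%g t) y.
  by move=> yn; rewrite -(tnth_nth 1%g (face k t) (Ordinal yn)) tnth_mktuple.
rewrite -[RHS](_ : facef j.-1 (facef i (nth 1%g t)) x = _); last first.
  by rewrite {1 3}/facef !E //; have := ltn_ord x; lia.
by rewrite -facef_comm // {1 3}/facef !E //; have := ltn_ord x; lia.
Qed.
End FaceIdentities.

Fact alternating_sum (V : zmodType) (X : nat -> nat -> V) m :
  (forall i j, (i < j <= m)%N -> X i j = X j.-1 i) ->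
  \sum_(0 <= j < m.+1) \sum_(0 <= i < m) X i j *~ ((-1) ^+ (i + j)) = 0.
Proof.
elim: m => [|m IHm] XP; first by rewrite big1 // => j _; rewrite big_geq.
rewrite big_nat_recr //=.
under eq_bigr => j _ do rewrite big_nat_recr //=.
rewrite big_split /= IHm; last by move=> i j ij; apply: XP; lia.
rewrite add0r big_nat_recr //= [X in _ + X]big_nat_recr //=.
rewrite [X _ m.+1]XP /= ?ltnS ?leqnn // addnS exprS mulN1r mulrNz.
rewrite addrACA subrr addr0 -big_split /=.
rewrite big_nat_cond big1 // => i /andP[im _].
rewrite [X i _]XP /=; last lia.
by rewrite addnS exprS mulN1r mulrNz addnC subrr.
Qed.

Lemma bar_bdbd n x : bar_bd n (bar_bd n.+1 x) = 0.
Proof.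
apply: (@fg_ext _ _ (bar_bd n \o bar_bd n.+1) \0) => t /=.
rewrite bar_bdU mulr1z bar_bd_symbolE raddf_sum.
rewrite -[RHS](@alternating_sum _ (fun i j => << face i (face j t) >>) n.+2);
  last first.
  by move=> i j ij; congr << _ >>; apply: face_comm.
apply: eq_bigr => j _; rewrite /= bar_bdU bar_bd_symbolE mulrz_suml.
apply: eq_bigr => i _; rewrite !freeg_mulz; congr << _ *g _ >>.
by rewrite exprD intz -mulrzr intz.
Qed.

Definition bar_complex : chain_complex :=
  @Complex (fun n => {freeg (n.-tuple G)}) bar_bd bar_bdbd.

End Bar.
Arguments bar_bd {G} n x.

(** Coefficients: [C (x) A] with boundary [d (x) 1] *)

Fact tensor_bdbd (C : chain_complex) (A : zmodType) n x :
  tensor_map (bd C n) idfun (tensor_map (bd C n.+1) idfun x) = 0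
     :> tensor (C n) A.
Proof.
apply: (@tensor_ext _ _ _ (tensor_map (bd C n) idfun \o
                           tensor_map (bd C n.+1) idfun) \0) => v w /=.
by rewrite !tensor_mapE bdbd pure0l.
Qed.

Definition tensor_complex (C : chain_complex) (A : zmodType) : chain_complex :=
  @Complex (fun n => tensor (C n) A)
    (fun n => tensor_map (bd C n) idfun) (@tensor_bdbd C A).

(** Actions by group automorphisms *)

(* Every [aut_act q] is bijective, with inverse [aut_act q^-1]. *)
Record aut_action (Q : finGroupType) (G : groupType) := AutAction {
  aut_act :> Q -> G -> G;
  aut_actM : forall q, {morph aut_act q : g h / (g * h)%g};
  aut_act1 : forall g, aut_act 1%g g = g;
  aut_act_comp : forall q r g, aut_act (q * r)%g g = aut_act q (aut_act r g)
}.

Section BarAction.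
Variables (Q : finGroupType) (G : groupType) (rho : aut_action Q G).

Definition bar_act n (q : Q) : {freeg (n.-tuple G)} -> {freeg (n.-tuple G)} :=
  fglin (fun t : n.-tuple G => << [tuple of map (rho q) t] >>).
Arguments bar_act n q x : clear implicits.
HB.instance Definition _ n q :=
  GRing.isZmodMorphism.Build _ _ (bar_act n q) (fglin_is_zmod_morphism _).

Lemma bar_actU n q c t :
  bar_act n q << c *g t >> = << c *g [tuple of map (rho q) t] >>.
Proof. by rewrite /bar_act fglinU freeg_mulz intz. Qed.

Lemma face_act n i q (t : n.+1.-tuple G) :
  face i [tuple of map (rho q) t] = [tuple of map (rho q) (face i t)].
Proof.
apply: eq_from_tnth => j; rewrite tnth_map !tnth_mktuple /facef.
have E k : (k < n.+1)%N -> nth 1%g (map (rho q) t) k = rho q (nth 1%g t k).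
  by move=> kn; rewrite (nth_map 1%g) ?size_tuple.
have := ltn_ord j; do 2?[case: ifP => _] => jn; rewrite !E ?aut_actM //; lia.
Qed.

Lemma bar_act_bd n q x :
  bar_act n q (bar_bd n x) = bar_bd n (bar_act n.+1 q x).
Proof.
apply: (@fg_ext _ _ (bar_act n q \o bar_bd n)
                    (bar_bd n \o bar_act n.+1 q)) => t /=.
rewrite bar_actU !bar_bdU !mulr1z !bar_bd_symbolE raddf_sum.
by apply: eq_bigr => i _; rewrite /= bar_actU face_act.
Qed.

Variable A : zmodType.

Definition bar_act_coef n (q : Q) :
    tensor {freeg (n.-tuple G)} A -> tensor {freeg (n.-tuple G)} A :=
  tensor_map (bar_act n q) idfun.
Arguments bar_act_coef n q x : clear implicits.
HB.instance Definition _ n q :=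
  GRing.isZmodMorphism.Build _ _ (bar_act_coef n q)
    (tensor_map_is_zmod_morphism (bar_act n q) idfun).

Lemma bar_act_coefE n q t a :
  bar_act_coef n q (pure << t >> a) = pure << [tuple of map (rho q) t] >> a.
Proof. by rewrite /bar_act_coef tensor_mapE /= bar_actU. Qed.

Fact bar_act_coef_bd q n x :
  bar_act_coef n q (bd (tensor_complex (bar_complex G) A) n x) =
  bd (tensor_complex (bar_complex G) A) n (bar_act_coef n.+1 q x).
Proof.
set d := bd _ n; pose f := bar_act_coef n q; pose g := bar_act_coef n.+1 q.
apply: (@tensor_ext _ _ _ (f \o d) (d \o g)) => v w.
by rewrite /f /g /d /= /bar_act_coef !tensor_mapE /= bar_act_bd.
Qed.

Definition bar_chain_act (q : Q) :
    chain_map (tensor_complex (bar_complex G) A)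
              (tensor_complex (bar_complex G) A) :=
  @ChainMap (tensor_complex (bar_complex G) A)
            (tensor_complex (bar_complex G) A)
            (fun n => bar_act_coef n q) (bar_act_coef_bd q).

Fact bar_chain_act1 n x : bar_chain_act 1%g n x = x.
Proof.
apply: (@tensor_ext _ _ _ (bar_act_coef n 1%g) idfun) => v w.
rewrite /= /bar_act_coef tensor_mapE /=; congr pure.
apply: (@fg_ext _ _ (bar_act n 1%g) idfun) => t.
rewrite /= bar_actU; congr << _ >>; apply: eq_from_tnth => j.
by rewrite tnth_map aut_act1.
Qed.

Fact bar_chain_actM q r n x :
  bar_chain_act (q * r)%g n x = bar_chain_act q n (bar_chain_act r n x).
Proof.
apply: (@tensor_ext _ _ _ (bar_act_coef n (q * r)%g)
         (bar_act_coef n q \o bar_act_coef n r)) => v w.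
rewrite /= /bar_act_coef !tensor_mapE /=; congr pure.
apply: (@fg_ext _ _ (bar_act n (q * r)%g) (bar_act n q \o bar_act n r)) => t.
rewrite /= !bar_actU; congr << _ >>; apply: eq_from_tnth => j.
by rewrite !tnth_map aut_act_comp.
Qed.

Definition bar_action :
    complex_action Q (tensor_complex (bar_complex G) A) :=
  ComplexAction bar_chain_act1 bar_chain_actM.

(** [H_n(G; A)], [H_n^Q(G; A)], [H_n(G; A)^Q] and [i_*] *)

Definition group_homology n : zmodType :=
  homology (tensor_complex (bar_complex G) A) n.

Definition Q_homology n : zmodType := homology (inv_complex bar_action) n.

Definition group_homology_inv n : zmodType := inv_homology bar_action n.

Definition i_star n : {additive Q_homology n -> group_homology_inv n} :=
  inv_homology_map bar_action n.

Lemma i_starE n (z : cycles (inv_complex bar_action) n) :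
  zval (i_star n (hclass z)) = hclass (cycles_map (inv_incl bar_action) z).
Proof. exact: homology_mapE. Qed.
End BarAction.
Arguments bar_act {Q G} rho n q x.
Arguments bar_act_coef {Q G} rho A n q x.
Arguments i_star {Q G} rho A n.

(* Main.v *)
Require Import Defs.
From HB Require Import structures.
From mathcomp Require Import all_boot fingroup all_algebra.
From mathcomp Require Import generic_quotient.

(** Averaging over [Q] proves the statement for any complex [C] with a
    [Q]-action on whose groups multiplication by [#|Q|] is bijective
    ([inv_homology_map_bij]).  Write [N x] for the sum of the translates of a
    chain [x]: it is [Q]-invariant, [N] commutes with the boundary, and [N] is
    multiplication by [#|Q|] on invariant chains, and on invariant homology
    classes.

    Injectivity of [i_*]: if an invariant cycle [z] is the boundary of [y], then
    [N y] is invariant with boundary [z *+ #|Q|], and dividing [N y] by [#|Q|]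
    exhibits [z] as the boundary of an invariant chain.  Surjectivity: if the
    class of [z] is invariant, then [N z] represents [#|Q|] times that class, so
    the quotient of [N z] by [#|Q|] is an invariant cycle which represents the
    class itself, because multiplication by [#|Q|] is also injective on homology
    ([homology_mulrn_inj]).

    Dividing by [#|Q|] keeps invariant chains invariant and cycles cycles:
    additive maps preserve multiples, and multiplication by [#|Q|] is injective on
    chains, so both conditions may be checked on [#|Q|]-fold multiples.  Finally
    the groups [C_n(G) (x) A] have the required divisibility, since an inverse of
    multiplication by [#|Q|] on [A] induces one on the tensor product
    ([tensor_mulrn_bij]). *)

Set Implicit Arguments.
Unset Strict Implicit.
Unset Printing Implicit Defensive.

Import GRing.Theory.
Local Open Scope ring_scope.

Lemma inj_surj_bijective (T U : choiceType) (f : T -> U) :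
  injective f -> (forall y, exists x, f x = y) -> bijective f.
Proof.
move=> f_inj f_surj.
have fP y : exists x, f x == y by have [x <-] := f_surj y; exists x.
exists (fun y => xchoose (fP y)) => [x|y]; last exact/eqP/(xchooseP (fP y)).
exact/f_inj/eqP/(xchooseP (fP (f x))).
Qed.

Section TensorDivision.
Variables (V A : zmodType) (m : nat).
Hypothesis mA : bijective (fun a : A => a *+ m).

(** An inverse [s] of multiplication by [m] on [A] is additive, hence
    [v (x) a |-> v (x) s a] is well defined; it inverts multiplication by [m]
    because [m] can be moved to the second factor. *)
Lemma tensor_mulrn_bij : bijective (fun x : tensor V A => x *+ m).
Proof.
have [s mK sK] := mA.
have sD : {morph s : a b / a + b}.
  by move=> a b; apply: (can_inj mK); rewrite mulrnDl !sK.
have fDl a : {morph (fun v : V => pure v (s a)) : v v' / v + v'}.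
  by move=> v v'; rewrite pureDl.
have fDr (v : V) : {morph (fun a => pure v (s a)) : a b / a + b}.
  by move=> a b; rewrite sD pureDr.
have pureMn (v : V) a : pure v (a *+ m) = pure v a *+ m.
  elim: m => [|k IHk]; last by rewrite !mulrSr pureDr IHk.
  by apply: (addrI (pure v 0)); rewrite mulr0n -pureDr !addr0.
pose S : {additive tensor V A -> tensor V A} := tensor_lift fDl fDr.
have SK x : S x *+ m = x.
  rewrite -raddfMn.
  have mB : zmod_morphism (fun y : tensor V A => y *+ m).
    by move=> y z; rewrite mulrnBl.
  pose M : {additive tensor V A -> tensor V A} :=
    HB.pack (fun y : tensor V A => y *+ m) (GRing.isZmodMorphism.Build _ _ _ mB).
  apply: (@tensor_ext _ _ _ (S \o M) idfun) => v a /=.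
  by rewrite raddfMn /= tensor_liftE -pureMn sK.
by exists S => x; rewrite ?raddfMn SK.
Qed.
End TensorDivision.

(** Division by [m] is available on chains, so a primitive of [z *+ m] can be
    divided to give a primitive of [z]. *)
Lemma homology_mulrn_inj (C : chain_complex) (m n : nat) :
    (forall k, bijective (fun x : C k => x *+ m)) ->
  injective (fun h : homology C n => h *+ m).
Proof.
move=> mC h h' /= /eqP; rewrite -subr_eq0 -mulrnBl -[h - h']qclassK => /eqP.
rewrite -raddfMn => /eqP; rewrite -(raddf0 (qclass _)) qclass_eq subr0.
case/is_boundaryP => y; have [s _ sK] := mC n.+1; rewrite -(sK y).
rewrite !raddfMn => /(bij_inj (mC n)) zE.
apply/eqP; rewrite -subr_eq0 -[h - h']qclassK -(raddf0 (qclass _)) qclass_eq.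
by rewrite subr0; apply/is_boundaryP; exists (s y).
Qed.

Section Averaging.
Variables (Q : finGroupType) (C : chain_complex) (rho : complex_action Q C).
Hypothesis QC : forall n, bijective (fun x : C n => x *+ #|Q|).

Let mulQI n : injective (fun x : C n => x *+ #|Q|) := bij_inj (QC n).

Lemma inv_chain_sum n (x : C n) : \sum_q rho q n x \in inv_chain rho n.
Proof.
apply/forallP => r; apply/eqP; rewrite raddf_sum [RHS](reindex_inj (mulgI r)) /=.
by apply: eq_bigr => q _; rewrite cactM.
Qed.

Lemma inv_chain_div n (x : C n) :
  x *+ #|Q| \in inv_chain rho n -> x \in inv_chain rho n.
Proof.
move=> /forallP xQ; apply/forallP => q; apply/eqP/mulQI.
by rewrite /= -raddfMn (eqP (xQ q)).
Qed.

Lemma is_cycle_div n (x : C n) : x *+ #|Q| \in is_cycle C n -> x \in is_cycle C n.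
Proof.
case: n x => [//|n] x; rewrite !unfold_in /= raddfMn => /eqP dx.
by apply/eqP/mulQI; rewrite /= dx mul0rn.
Qed.

(** The average of an arbitrary primitive of an invariant cycle is an invariant
    primitive. *)
Lemma inv_homology_map_inj n : injective (inv_homology_map rho n).
Proof.
apply: raddf_inj => h; rewrite -[h]qclassK; set z := repr h => hz.
have: hclass (cycles_map (inv_incl rho) z) = 0.
  by rewrite -homology_mapE; have := congr1 zval hz.
move=> /eqP; rewrite -(raddf0 (qclass _)) qclass_eq subr0.
case/is_boundaryP => y /= zE; have [s _ sK] := QC n.+1.
have wQ : s (\sum_q rho q n.+1 y) \in inv_chain rho n.+1.
  by apply: inv_chain_div; rewrite sK inv_chain_sum.
apply/eqP; rewrite -(raddf0 (qclass _)) qclass_eq subr0.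
apply/is_boundaryP; exists (SubGrp wQ).
apply: zval_inj; apply: mulQI; rewrite /= -(raddfMn (bd C n)) sK raddf_sum.
rewrite -sumr_const; apply: eq_bigr => q _.
by rewrite -cmapP -zE inv_chainP.
Qed.

(** A representative of an invariant class is moved by [Q] only up to
    boundaries, so averaging it keeps its class and makes it invariant. *)
Lemma inv_homology_map_surj n (h : inv_homology rho n) :
  exists x, inv_homology_map rho n x = h.
Proof.
have hQ q : homology_map (rho q) n (zval h) = zval h.
  by have /forallP/(_ q)/eqP := zvalP h.
set z : cycles C n := repr (zval h).
have zE : hclass z = zval h by exact: qclassK.
pose w := \sum_q cycles_map (rho q) z.
have wE : zval w = \sum_q rho q n (zval z) by rewrite raddf_sum.
have [s _ sK] := QC n; set u := s (zval w).
have uQ : u \in inv_chain rho n.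
  by apply: inv_chain_div; rewrite sK wE inv_chain_sum.
have uZ : u \in is_cycle C n by apply: is_cycle_div; rewrite sK zvalP.
have cZ : SubGrp uQ \in is_cycle (inv_complex rho) n.
  (* The definition of cycles is by cases on the degree. *)
  clearbody u; clear -uZ; case: n u uQ uZ => [//|k] u uQ.
  by rewrite !unfold_in /= => /eqP du; apply/eqP/zval_inj.
exists (hclass (SubGrp cZ)); apply: zval_inj; apply: (homology_mulrn_inj QC).
rewrite /= homology_mapE -[LHS]raddfMn.
have -> : cycles_map (inv_incl rho) (SubGrp cZ) *+ #|Q| = w.
  by apply: zval_inj; rewrite raddfMn /= sK.
rewrite raddf_sum -sumr_const; apply: eq_bigr => q _.
by rewrite -[LHS]homology_mapE zE hQ.
Qed.

Lemma inv_homology_map_bij n : bijective (inv_homology_map rho n).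
Proof.
exact: inj_surj_bijective (@inv_homology_map_inj n) (@inv_homology_map_surj n).
Qed.
End Averaging.

Theorem proposition3p3 (G : groupType) (Q : finGroupType)
    (rho : aut_action Q G) (A : zmodType)
    (hA : bijective (fun a : A => a *+ #|Q|)) :
  forall n : nat, bijective (i_star rho A n).
Proof.
by move=> n; apply: inv_homology_map_bij => k; apply: tensor_mulrn_bij.
Qed.
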